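(* (The Third Isomorphism Theorem) Let $G$ be a gyrogroup and let $H,K$ be normal subgyrogroups of $G$ such that $H\subseteq K$. Then $K/H$ is normal in $G/H$ and $(G/H)/(K/H)\cong G/K$ as gyrogroups.
   Context: A gyrogroup is a nonempty set $G$ with a binary operation $\oplus$ such that: (G1) there is $0\in G$ with $0\oplus a=a$ for all $a$; (G2) for each $a$ there is $b$ with $b\oplus a=0$; (G3) for all $a,b\in G$ there is an automorphism $\mathrm{gyr}[a,b]$ of $(G,\oplus)$ (a bijection $G\to G$ preserving $\oplus$) with $a\oplus(b\oplus c)=(a\oplus b)\oplus\mathrm{gyr}[a,b]c$ for all $c\in G$; (G4) $\mathrm{gyr}[a,b]=\mathrm{gyr}[a\oplus b,b]$ for all $a,b\in G$. It is known that $0$ is a two-sided identity and every $a$ has a two-sided inverse $\ominus a$. A nonempty subset $H$ of $G$ is a subgyrogroup if $H$ is a gyrogroup under the operation inherited from $G$ and, for all $a,b\in H$, the restriction of $\mathrm{gyr}[a,b]$ to $H$ is an automorphism of $H$. A gyrogroup homomorphism is a map between gyrogroups preserving the operations; its kernel is the preimage of $\{0\}$. Gyrogroups are isomorphic ($\cong$) if there is a bijective homomorphism between them. A subgyrogroup $N$ of $G$ is normal in $G$ if it is the kernel of some gyrogroup homomorphism from $G$ to some gyrogroup. For $N$ normal in $G$, $G/N$ is the quotient gyrogroup: the set of left cosets $a\oplus N=\{a\oplus n:n\in N\}$, $a\in G$, with the well-defined operation $(a\oplus N)\oplus(b\oplus N)=(a\oplus b)\oplus N$. For $H\subseteq K$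 as in the claim, $K/H=\{k\oplus H:k\in K\}\subseteq G/H$. *)

(* Defs.v *)
From HB Require Import structures.
From mathcomp Require Import all_boot all_classical.

Set Implicit Arguments.
Unset Strict Implicit.
Unset Printing Implicit Defensive.

Local Open Scope classical_set_scope.

Definition automorphism (T : Type) (op : T -> T -> T) (f : T -> T) : Prop :=
  bijective f /\ {morph f : x y / op x y}.

Record gyrogroup_axioms (T : Type) (op : T -> T -> T) (zero : T)
    (gyr : T -> T -> T -> T) : Prop := GyrogroupAxioms {
  axiom_G1 : forall a, op zero a = a;
  axiom_G2 : forall a, exists b, op b a = zero;
  axiom_G3_aut : forall a b, automorphism op (gyr a b);
  axiom_G3 : forall a b c, op a (op b c) = op (op a b) (gyr a b c);
  axiom_G4 : forall a b, gyr a b = gyr (op a b) b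
}.

(* The axioms determine [gzero] and [gyr] from [gadd] (see [gaddr0]
   and [gadd_inj]), so recording them as data adds no structure. *)
HB.mixin Record isGyrogroup (G : Type) := {
  gadd : G -> G -> G;
  gzero : G;
  gyr : G -> G -> G -> G;
  gyrogroupP : gyrogroup_axioms gadd gzero gyr
}.

#[short(type="gyrogroupType")]
HB.structure Definition Gyrogroup := { G of isGyrogroup G }.

Declare Scope gyro_scope.
Delimit Scope gyro_scope with gyro.
Notation "x ⊕ y" := (gadd x y) (at level 50, left associativity) : gyro_scope.
Local Open Scope gyro_scope.

Arguments gzero {s}.

Definition gyro_hom (G L : gyrogroupType) (f : G -> L) : Prop :=
  {morph f : x y / x ⊕ y}.

Definition gyro_ker (G L : gyrogroupType) (f : G -> L) : set G :=
  f @^-1` [set gzero].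

Definition gyro_isomorphic (G L : gyrogroupType) : Prop :=
  exists f : G -> L, gyro_hom f /\ bijective f.

Definition gadd_closed (G : gyrogroupType) (H : set G) : Prop :=
  forall a b, H a -> H b -> H (a ⊕ b).

Definition sub_gadd (G : gyrogroupType) (H : set G) (clH : gadd_closed H)
    (x y : {a | H a}) : {a | H a} :=
  exist H (sval x ⊕ sval y) (clH _ _ (svalP x) (svalP y)).

Definition restricts_to_automorphism (G : gyrogroupType) (H : set G)
    (f : G -> G) : Prop :=
  set_bij H H f /\ forall x y, H x -> H y -> f (x ⊕ y) = f x ⊕ f y.

Definition subgyrogroup (G : gyrogroupType) (H : set G) : Prop :=
  [/\ H !=set0,
      exists (clH : gadd_closed H) (zero : {a | H a})
             (gyrH : {a | H a} -> {a | H a} -> {a | H a} -> {a | H a}),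
        gyrogroup_axioms (sub_gadd clH) zero gyrH &
      forall a b, H a -> H b -> restricts_to_automorphism H (gyr a b)].

Definition normal_subgyrogroup (G : gyrogroupType) (N : set G) : Prop :=
  subgyrogroup N /\
  exists (L : gyrogroupType) (f : G -> L), gyro_hom f /\ N = gyro_ker f.

Definition lcoset (G : gyrogroupType) (N : set G) (a : G) : set G :=
  [set a ⊕ n | n in N].

Section GyrogroupTheory.
Variable G : gyrogroupType.
Implicit Types a b c : G.

Lemma gadd_inj a : injective (gadd a).
Proof.
have [G1 G2 G3a G3 _] := @gyrogroupP G.
move=> b c bc; have [a' a'a] := G2 a.
have [/bij_inj inj _] := G3a a' a.
by apply: inj; rewrite -[LHS]G1 -[RHS]G1 -a'a -!G3 bc.
Qed.

Lemma gyr0 b c : gyr gzero b c = c.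
Proof.
have [G1 _ _ G3 _] := @gyrogroupP G.
by apply: (@gadd_inj b); rewrite -{1}(G1 b) -G3 G1.
Qed.

Lemma gaddK a a' b : a' ⊕ a = gzero -> a' ⊕ (a ⊕ b) = b.
Proof.
have [G1 _ _ G3 G4] := @gyrogroupP G.
by move=> a'a; rewrite G3 G4 a'a gyr0 G1.
Qed.

Lemma gaddr0 a : a ⊕ gzero = a.
Proof.
have [_ G2 _ _ _] := @gyrogroupP G.
by have [a' a'a] := G2 a; apply: (@gadd_inj a'); rewrite (gaddK _ a'a) a'a.
Qed.

Lemma ginv_exists a : exists b, b ⊕ a = gzero /\ a ⊕ b = gzero.
Proof.
have [_ G2 _ _ _] := @gyrogroupP G.
have [b ba] := G2 a; have [c cb] := G2 b; exists b; split=> //.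
by have := gaddK a cb; rewrite ba gaddr0 => <-.
Qed.

End GyrogroupTheory.

Section HomTheory.
Variables (G L : gyrogroupType) (f : G -> L).
Hypothesis fM : gyro_hom f.

Lemma gyro_hom0 : f gzero = gzero.
Proof. by apply: (@gadd_inj _ (f gzero)); rewrite -fM !gaddr0. Qed.

Lemma gyro_hom_gyr a b c : f (gyr a b c) = gyr (f a) (f b) (f c).
Proof.
apply: (@gadd_inj _ (f a ⊕ f b)).
by rewrite -(axiom_G3 gyrogroupP) -!fM -(axiom_G3 gyrogroupP).
Qed.

Lemma lcoset_ker_eq a b : lcoset (gyro_ker f) a = lcoset (gyro_ker f) b <->
  f a = f b.
Proof.
split=> [ab|].
  have : lcoset (gyro_ker f) a a.
    by exists gzero; [exact: gyro_hom0 | exact: gaddr0].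
  by rewrite ab => -[n fn <-]; rewrite fM fn gaddr0.
move=> ab; suff sub x y : f x = f y ->
    lcoset (gyro_ker f) x `<=` lcoset (gyro_ker f) y.
  by apply/seteqP; split; apply: sub.
move=> xy _ [n fn <-]; have [y' [y'y yy']] := ginv_exists y.
exists (y' ⊕ (x ⊕ n)); last by rewrite (gaddK _ yy').
by rewrite /gyro_ker /= !fM fn gaddr0 xy -fM y'y gyro_hom0.
Qed.

End HomTheory.

(* The normality proof is a phantom argument: it lets the gyrogroup structure
   below be attached to the type. *)
Definition quotient (G : gyrogroupType) (N : set G) (nN : normal_subgyrogroup N) : Type :=
  {A : set G | exists a, A = lcoset N a}.

Section Quotient.
Variables (G : gyrogroupType) (N : set G) (nN : normal_subgyrogroup N).
Local Notation Q := (quotient nN).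

Definition coset (a : G) : Q := exist _ (lcoset N a) (ex_intro _ a erefl).

Definition coset_repr (A : Q) : G := sval (cid (svalP A)).

(* [quotient_addE] shows independence of the chosen representatives. *)
Definition quotient_add (A B : Q) : Q := coset (coset_repr A ⊕ coset_repr B).

Definition quotient_gyr (A B C : Q) : Q :=
  coset (gyr (coset_repr A) (coset_repr B) (coset_repr C)).

Lemma coset_reprK A : coset (coset_repr A) = A.
Proof.
case: A => A AP; apply: eq_exist.
by rewrite /coset_repr; case: cid => a /= ->.
Qed.

Lemma coset_eq a b : coset a = coset b <-> lcoset N a = lcoset N b.
Proof. by split=> [/(congr1 sval)//|ab]; apply: eq_exist. Qed.

Lemma coset_hom : exists (L : gyrogroupType) (f : G -> L),
  gyro_hom f /\ forall x y, coset x = coset y <-> f x = f y.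
Proof.
have [_ [L [f [fM NE]]]] := nN; exists L, f; split=> // x y.
by rewrite coset_eq NE; exact: lcoset_ker_eq.
Qed.

Lemma quotient_addE a b : quotient_add (coset a) (coset b) = coset (a ⊕ b).
Proof.
have [L [f [fM E]]] := coset_hom.
by apply/E; rewrite !fM; congr (_ ⊕ _); apply/E; rewrite coset_reprK.
Qed.

Lemma quotient_gyrE a b c :
  quotient_gyr (coset a) (coset b) (coset c) = coset (gyr a b c).
Proof.
have [L [f [fM E]]] := coset_hom.
have R x : f (coset_repr (coset x)) = f x by apply/E; rewrite coset_reprK.
by apply/E; rewrite !(gyro_hom_gyr fM) !R.
Qed.

Lemma quotient_gyr_bij A B : bijective (quotient_gyr A B).
Proof.
have [L [f [fM E]]] := coset_hom.
rewrite -(coset_reprK A) -(coset_reprK B).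
move: (coset_repr A) (coset_repr B) => a b.
have [[g gK Kg] _] := axiom_G3_aut (@gyrogroupP G) a b.
have gE x : quotient_gyr (coset a) (coset b) (coset (g x)) = coset x.
  by rewrite quotient_gyrE Kg.
have inj : injective (quotient_gyr (coset a) (coset b)).
  move=> C D; rewrite -(coset_reprK C) -(coset_reprK D) !quotient_gyrE.
  move=> /E; rewrite !(gyro_hom_gyr fM) => CD; apply/E.
  by have [/bij_inj + _] := axiom_G3_aut (@gyrogroupP L) (f a) (f b); apply.
exists (fun C => coset (g (coset_repr C))) => C; last by rewrite gE coset_reprK.
by apply: inj; rewrite gE coset_reprK.
Qed.

Lemma quotient_axioms :
  gyrogroup_axioms quotient_add (coset gzero) quotient_gyr.
Proof.
have [G1 G2 G3a G3 G4] := @gyrogroupP G.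
split.
- by move=> A; rewrite -(coset_reprK A) quotient_addE G1.
- move=> A; have [b ba] := G2 (coset_repr A); exists (coset b).
  by rewrite -(coset_reprK A) quotient_addE ba.
- move=> A B; split=> [|C D]; first exact: quotient_gyr_bij.
  rewrite -(coset_reprK A) -(coset_reprK B) -(coset_reprK C) -(coset_reprK D).
  by rewrite !(quotient_addE, quotient_gyrE); congr coset; apply: (G3a _ _).2.
- move=> A B C; rewrite -(coset_reprK A) -(coset_reprK B) -(coset_reprK C).
  by rewrite !(quotient_addE, quotient_gyrE) G3.
- move=> A B; apply/funext => C.
  rewrite -(coset_reprK A) -(coset_reprK B) -(coset_reprK C).
  by rewrite !(quotient_addE, quotient_gyrE) G4.
Qed.

HB.instance Definition _ := isGyrogroup.Build Q quotient_axioms.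

Definition quotient_image (K : set G) : set Q := [set coset k | k in K].

End Quotient.

Arguments quotient_image {G N} nN K _ : rename.

(* Main.v *)
Require Import Defs.
From mathcomp Require Import all_boot all_classical.
Set Implicit Arguments.
Unset Strict Implicit.
Unset Printing Implicit Defensive.
Local Open Scope classical_set_scope.
Local Open Scope gyro_scope.

(** The projection [coset nK : G -> G/K] kills [H], because [H] is contained
in [K], so it factors through a homomorphism [G/H -> G/K].  The latter sends
the class of [a] to the class of [a], so it is onto and its kernel is [K/H]
([gyro_ker_quotient_lift]).  Being a kernel, [K/H] is normal
([gyro_ker_normal]), and the first isomorphism theorem
([first_isomorphism]) identifies the quotient of [G/H] by [K/H] with [G/K].

Normality asks for more than being a kernel: the kernel must itself be a
subgyrogroup, stable under gyrations.  This holds because a homomorphism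
commutes with gyrations and a gyration is a bijection fixing [gzero], so
[gyr a b] preserves the kernel in both directions ([gyro_ker_gyr]). *)

(** Evaluating the gyroassociative law at [gzero] and cancelling [a ⊕ b] shows
that [gyr a b] fixes [gzero]; injectivity gives the converse. *)
Lemma gyr_eq0 (G : gyrogroupType) (a b c : G) :
  gyr a b c = gzero <-> c = gzero.
Proof.
have [_ _ _ G3 _] := @gyrogroupP G.
have [/bij_inj inj _] := axiom_G3_aut (@gyrogroupP G) a b.
have gyr_0 : gyr a b gzero = gzero.
  by apply: (@gadd_inj _ (a ⊕ b)); rewrite -G3 !gaddr0.
by split=> [|->//]; rewrite -{1}gyr_0 => /inj.
Qed.

Section Kernel.
Variables (G L : gyrogroupType) (f : G -> L).
Hypothesis fM : gyro_hom f.

(** The equivalence is used from right to left to restrict [gyr a b] to the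
kernel, and from left to right to restrict its inverse. *)
Lemma gyro_ker_gyr a b c : gyro_ker f (gyr a b c) <-> gyro_ker f c.
Proof. by rewrite /gyro_ker /= (gyro_hom_gyr fM); exact: gyr_eq0. Qed.

Lemma gyro_ker0 : gyro_ker f gzero.
Proof. exact: gyro_hom0. Qed.

Lemma gyro_ker_closed : gadd_closed (gyro_ker f).
Proof. by move=> a b fa fb; rewrite /gyro_ker /= fM fa fb gaddr0. Qed.

Definition gyro_ker_gyration (x y z : {a | gyro_ker f a}) : {a | gyro_ker f a} :=
  exist _ (gyr (sval x) (sval y) (sval z))
    ((gyro_ker_gyr (sval x) (sval y) (sval z)).2 (svalP z)).

Lemma gyro_ker_gyration_bij x y : bijective (gyro_ker_gyration x y).
Proof.
have [[g gK Kg] _] := axiom_G3_aut (@gyrogroupP G) (sval x) (sval y).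
have g_ker c : gyro_ker f c -> gyro_ker f (g c).
  by move=> fc; apply/(gyro_ker_gyr (sval x) (sval y)); rewrite Kg.
exists (fun z => exist _ (g (sval z)) (g_ker _ (svalP z))).
- by case=> z fz; apply: eq_exist; rewrite /= gK.
- by case=> z fz; apply: eq_exist; rewrite /= Kg.
Qed.

Lemma gyro_ker_axioms :
  gyrogroup_axioms (sub_gadd gyro_ker_closed) (exist _ gzero gyro_ker0)
    gyro_ker_gyration.
Proof.
have [G1 G2 G3a G3 G4] := @gyrogroupP G.
split.
- by case=> a fa; apply: eq_exist; exact: G1.
- case=> a fa; have [b ba] := G2 a.
  have fb : gyro_ker f b.
    have : f (b ⊕ a) = gzero by rewrite ba (gyro_hom0 fM).
    by rewrite fM fa gaddr0.
  by exists (exist _ b fb); apply: eq_exist.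
- move=> x y; split; first exact: gyro_ker_gyration_bij.
  by move=> z t; apply: eq_exist; apply: (G3a _ _).2.
- by move=> x y z; apply: eq_exist; exact: G3.
- by move=> x y; apply/funext => z; apply: eq_exist; rewrite /= G4.
Qed.

Lemma gyr_restricts_to_gyro_ker a b :
  restricts_to_automorphism (gyro_ker f) (gyr a b).
Proof.
have [[g gK Kg] gyrD] := axiom_G3_aut (@gyrogroupP G) a b.
split=> [|x y _ _]; last exact: gyrD.
split=> [x fx|x y _ _|y fy].
- exact/gyro_ker_gyr.
- exact: can_inj gK x y.
- by exists (g y) => //; apply/(gyro_ker_gyr a b); rewrite Kg.
Qed.

Lemma gyro_ker_normal : normal_subgyrogroup (gyro_ker f).
Proof.
split; last by exists L, f.
split.
- by exists gzero; exact: gyro_ker0.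
- exists gyro_ker_closed, (exist _ gzero gyro_ker0), gyro_ker_gyration.
  exact: gyro_ker_axioms.
- by move=> a b _ _; exact: gyr_restricts_to_gyro_ker.
Qed.

End Kernel.

Section QuotientLift.
Variables (G : gyrogroupType) (N : set G) (nN : normal_subgyrogroup N).

Lemma coset_gyro_hom : gyro_hom (coset nN).
Proof. by move=> a b; rewrite -quotient_addE. Qed.

Lemma coset_ker_eq (L : gyrogroupType) (f : G -> L) a b :
  gyro_hom f -> N = gyro_ker f -> coset nN a = coset nN b <-> f a = f b.
Proof. by move=> fM NE; rewrite coset_eq NE; exact: lcoset_ker_eq. Qed.

Lemma gyro_ker_coset : gyro_ker (coset nN) = N.
Proof.
have [_ [L [f [fM NE]]]] := nN.
have N_iff a : N a <-> f a = f gzero by rewrite NE (gyro_hom0 fM).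
by apply/seteqP; split=> a; [move/(coset_ker_eq _ _ fM NE)/N_iff
  | move/N_iff/(coset_ker_eq _ _ fM NE)].
Qed.

Lemma normal_subgyrogroup0 : N gzero.
Proof.
by have [_ [L [f [fM ->]]]] := nN; exact: gyro_ker0.
Qed.

Variables (L : gyrogroupType) (h : G -> L).

Definition quotient_lift (A : quotient nN) : L := h (coset_repr A).

Hypotheses (hM : gyro_hom h) (Nh : N `<=` gyro_ker h).

(** The lift does not depend on representatives: two representatives of a
coset differ by an element of [N] on the right, which [h] sends to
[gzero]. *)
Lemma quotient_liftE a : quotient_lift (coset nN a) = h a.
Proof.
rewrite /quotient_lift; set b := coset_repr _.
have /coset_eq ba : coset nN b = coset nN a by exact: coset_reprK.
have : lcoset N b b.
  by exists gzero; [exact: normal_subgyrogroup0 | exact: gaddr0].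
by rewrite ba => -[n /Nh hn <-]; rewrite hM hn gaddr0.
Qed.

Lemma quotient_lift_hom : gyro_hom quotient_lift.
Proof.
move=> A B; rewrite -(coset_reprK A) -(coset_reprK B) -coset_gyro_hom.
by rewrite !quotient_liftE hM.
Qed.

Lemma gyro_ker_quotient_lift :
  gyro_ker quotient_lift = quotient_image nN (gyro_ker h).
Proof.
apply/seteqP; split=> [A hA|_ [a ha <-]].
- by exists (coset_repr A); last exact: coset_reprK.
- by rewrite /gyro_ker /= quotient_liftE.
Qed.

Lemma quotient_lift_surj :
  (forall y, exists a, h a = y) -> forall y, exists A, quotient_lift A = y.
Proof.
by move=> hs y; have [a <-] := hs y; exists (coset nN a); exact: quotient_liftE.
Qed.

End QuotientLift.

(** The lift of [f] is injective because two elements are in the same coset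
of [N] exactly when [f] identifies them ([coset_ker_eq]). *)
Lemma first_isomorphism (G L : gyrogroupType) (f : G -> L) (N : set G)
    (nN : normal_subgyrogroup N) :
  gyro_hom f -> N = gyro_ker f -> (forall y, exists a, f a = y) ->
  gyro_isomorphic (quotient nN) L.
Proof.
move=> fM NE fs; have Nf : N `<=` gyro_ker f by rewrite NE.
exists (quotient_lift (nN := nN) f); split; first exact: quotient_lift_hom.
have [g gK] := choice fs.
exists (fun y => coset nN (g y)) => [A|y]; last by rewrite quotient_liftE.
by rewrite -[RHS]coset_reprK; apply/(coset_ker_eq _ _ _ fM NE); rewrite gK.
Qed.

Theorem theorem5p9 (G : gyrogroupType) (H K : set G)
    (nH : normal_subgyrogroup H) (nK : normal_subgyrogroup K) (HK : H `<=` K) :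
  exists nKH : normal_subgyrogroup (quotient_image nH K),
    gyro_isomorphic (quotient nKH) (quotient nK).
Proof.
have Hker : H `<=` gyro_ker (coset nK) by rewrite gyro_ker_coset.
have pM := quotient_lift_hom (nN := nH) (coset_gyro_hom nK) Hker.
have kerE := gyro_ker_quotient_lift nH (coset_gyro_hom nK) Hker.
rewrite gyro_ker_coset in kerE.
have nKH : normal_subgyrogroup (quotient_image nH K).
  by rewrite -kerE; exact: gyro_ker_normal.
exists nKH; apply: (first_isomorphism nKH pM); first by rewrite kerE.
apply: quotient_lift_surj => // [|B]; first exact: coset_gyro_hom.
by exists (coset_repr B); exact: coset_reprK.
Qed.
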